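(* Let $G=(V,E)$ be a finite strongly connected directed graph (possibly with loops) on $n$ vertices, with transition matrix $H$, and consider the pull voter model with agnostic nodes on $G$ (either synchronous or asynchronous), where vertices choose their neighbours (possibly themselves) according to the entries of $H$. Let $p$ be the smallest non-zero entry of $H$. Suppose the initial set of gnostic vertices is non-empty, and let $T_a$ be the number of rounds it takes for the agnostic vertices to disappear from the graph. Let $g(n)=\log n$ in the synchronous case and $g(n)=n\log n$ in the asynchronous case. Then for every function $C(n)$, $$\mathbb{P}\Big(T_a>\frac{C(n)\,n\,g(n)}{p}\Big)\le 2n^{-C(n)+2},$$ and $$\mathbb{E}[T_a]\le \frac{2\,n\,g(n)}{p}+4 .$$
   Context: Setting. The transition matrix $H$ is a row-stochastic $V\times V$ matrix with $H(v,u)>0$ if $(v,u)\in E$ and $H(v,u)=0$ otherwise. $\log$ is the natural logarithm. Pull voter model with agnostic nodes. Each node is, at each time, either agnostic (no colour) or gnostic (with a colour). In the synchronous version, at each round every node $v$ independently selects an out-neighbour $u$ with probability $H(v,u)$. If $u$ is agnostic, $v$ keeps its current state; if $u$ is gnostic, $v$ copies the colour of $u$ (and is then gnostic). All updates use the states at the start of the round and occur simultaneously. In the asynchronous version, at each round one node $v$ is chosen uniformly at random from $V$, it alone selects an out-neighbour (with probabilities $H(v,\cdot)$) and updates by the same rule. Gnostic nodes never become agnostic again. $T_a$ is the first time at which no node is agnostic. *)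

(* Defs.v *)
From mathcomp Require Import all_boot all_order all_algebra finmap.
From mathcomp Require Import all_classical all_reals all_analysis.

Set Implicit Arguments.
Unset Strict Implicit.
Unset Printing Implicit Defensive.

Import Order.TTheory GRing.Theory Num.Theory.
Import numFieldNormedType.Exports.

Local Open Scope classical_set_scope.
Local Open Scope ring_scope.

Definition strongly_connected (V : finType) (E : rel V) : Prop :=
  forall u v : V, connect E u v.

Definition transition_matrix (R : realType) (V : finType) (E : rel V)
    (H : V -> V -> R) : Prop :=
  [/\ forall v, \sum_(u : V) H v u = 1,
      forall v u, E v u -> 0 < H v u
    & forall v u, ~~ E v u -> H v u = 0].

Definition smallest_nonzero_entry (R : realType) (V : finType)
    (H : V -> V -> R) (p : R) : Prop :=
  [/\ p != 0, exists v u, H v u = p & forall v u, H v u != 0 -> p <= H v u].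

(* Measurability with respect to the discrete sigma-algebra on F. *)
Definition discrete_rv d (Omega : measurableType d) (F : Type)
    (Y : Omega -> F) : Prop :=
  forall B : set F, measurable (Y @^-1` B).

Definition mutually_independent d (Omega : measurableType d) (R : realType)
    (P : probability Omega R) (I : choiceType) (F : Type)
    (Y : I -> Omega -> F) : Prop :=
  forall (J : {fset I}) (B : I -> set F),
    P (\bigcap_(i in [set` J]) (Y i @^-1` B i))
      = (\prod_(i <- J) P (Y i @^-1` B i))%E.

(* [None] is agnostic, [Some c] is gnostic with colour [c]. *)
Definition config (V : finType) (K : Type) := V -> option K.

Definition pull (V : finType) (K : Type) (x : config V K) (v u : V) : option K :=
  if x u is Some c then Some c else x v.

Definition sync_step (V : finType) (K : Type) (x : config V K) (s : V -> V)
  : config V K := fun v => pull x v (s v).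

Definition async_step (V : finType) (K : Type) (x : config V K) (v u : V)
  : config V K := fun w => if w == v then pull x v u else x w.

Inductive schedule := Synchronous | Asynchronous.

(* [Y t v] is the out-neighbour selected by [v] in round [t]. *)
Definition sync_pull_process d (Omega : measurableType d) (R : realType)
    (P : probability Omega R) (V : finType) (K : Type) (H : V -> V -> R)
    (x0 : config V K) (X : nat -> Omega -> config V K) : Prop :=
  exists Y : nat -> V -> Omega -> V,
    [/\ forall t v, discrete_rv (Y t v),
        forall t v u, P (Y t v @^-1` [set u]) = (H v u)%:E,
        mutually_independent P (fun i : nat * V => Y i.1 i.2),
        forall w, X 0%N w = x0
      & forall t w, X t.+1 w = sync_step (X t w) (fun v => Y t v w)].

(* [Y t] is the pair (node chosen in round [t], out-neighbour it selects);
   its law says that the node is uniform on [V] and that, given that the node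
   is [v], the out-neighbour has law [H v]. *)
Definition async_pull_process d (Omega : measurableType d) (R : realType)
    (P : probability Omega R) (V : finType) (K : Type) (H : V -> V -> R)
    (x0 : config V K) (X : nat -> Omega -> config V K) : Prop :=
  exists Y : nat -> Omega -> V * V,
    [/\ forall t, discrete_rv (Y t),
        forall t v u, P (Y t @^-1` [set (v, u)]) = (#|V|%:R^-1 * H v u)%:E,
        mutually_independent P Y,
        forall w, X 0%N w = x0
      & forall t w, X t.+1 w = async_step (X t w) (Y t w).1 (Y t w).2].

Definition pull_process (s : schedule) d (Omega : measurableType d)
    (R : realType) (P : probability Omega R) (V : finType) (K : Type)
    (H : V -> V -> R) (x0 : config V K) (X : nat -> Omega -> config V K) : Prop :=
  match s with
  | Synchronous => sync_pull_process P H x0 X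
  | Asynchronous => async_pull_process P H x0 X
  end.

(* The infimum of the empty set is [+oo]: the time is infinite when some node
   stays agnostic forever. *)
Definition agnostic_time (Omega : Type) (R : realType) (V : finType) (K : Type)
    (X : nat -> Omega -> config V K) (w : Omega) : \bar R :=
  ereal_inf [set (t%:R)%:E | t in [set t : nat | forall v, X t w v <> None]].

Definition time_scale (R : realType) (s : schedule) (n : nat) : R :=
  match s with
  | Synchronous => ln n%:R
  | Asynchronous => n%:R * ln n%:R
  end.

(* Main.v *)
(** The gnostic set only grows. While it is neither empty nor everything, strong
    connectivity gives an edge [v -> u] with [v] agnostic and [u] gnostic; the
    next round uses it with probability at least [q] ([q = p] synchronously,
    [q = p / n] asynchronously), independently of the past. Hence
    [a t k = P (#gnostic at time t <= k)] satisfies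
    [a (t+1) (k+1) <= (1 - q) a t (k+1) + q a t k] with [a t 0 = 0]. Induction on
    [t] gives the Chernoff-type bound
    [a t (k+1) <= (1 - q (1 - z))^t z^-k] for every [z] in (0, 1], and summing
    over [t] gives [\sum_t a t k <= k / q]. With [k + 1 = n - 1], [z = 1 - 1/n],
    the first yields the tail, and the second the mean, since
    [E T_a = \sum_t P (T_a > t)]. *)

Require Import Defs.
From mathcomp Require Import all_boot all_order all_algebra finmap.
From mathcomp Require Import all_classical all_reals all_analysis.
From mathcomp Require Import measurable_realfun ring lra.

Import Order.TTheory GRing.Theory Num.Theory.
Import numFieldNormedType.Exports.

Local Open Scope classical_set_scope.
Local Open Scope ring_scope.

Set Implicit Arguments.
Unset Strict Implicit.
Unset Printing Implicit Defensive.

(** * The scalar recursion: exponential tail and summed bound *)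

Section spread_recursion.
Variables (R : realType) (q : R) (N : nat) (a : nat -> nat -> R).
Hypothesis q01 : 0 < q <= 1.
Hypothesis a01 : forall t k, 0 <= a t k <= 1.
Hypothesis at0 : forall t, a t 0%N = 0.
Hypothesis aS : forall t k, (k < N)%N ->
  a t.+1 k.+1 <= (1 - q) * a t k.+1 + q * a t k.

(** Lowering [k] by one multiplies the bound by [z], so one step of the recursion multiplies it by
    [(1 - q) + q * z = 1 - q * (1 - z)]. *)
Lemma spread_tail (z : R) t k : 0 < z <= 1 -> (k < N)%N ->
  a t k.+1 <= (1 - q * (1 - z)) ^+ t * z^-1 ^+ k.
Proof.
case/andP: q01 => q0 q1 /andP[z0 z1].
have zV1 : 1 <= z^-1 by rewrite invf_ge1.
have r0 : 0 <= 1 - q * (1 - z) by nra.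
elim: t k => [|t IH] k kN.
  rewrite expr0 mul1r; have /andP[_ a0] := a01 0%N k.+1.
  by apply: le_trans a0 _; exact: exprn_ege1.
apply: (le_trans (aS _ kN)).
rewrite exprS -mulrA; set B := _ ^+ t * _.
(* At [k = 0] the induction hypothesis says nothing; there [at0] makes the left side vanish. *)
have Bk : a t k <= z * B.
  case: k kN @B => [|k] kN B.
    rewrite at0 mulr_ge0 ?(ltW z0)//.
    by apply: mulr_ge0; apply: exprn_ge0 => //; rewrite invr_ge0 ltW.
  by rewrite /B exprS mulrCA [z * _]mulrA mulfV ?gt_eqF// mul1r IH// ltnW.
have := IH k kN; rewrite -/B => Bk1.
have := ler_wpM2l (ltW q0) Bk.
have q1' : 0 <= 1 - q by lra.
have := ler_wpM2l q1' Bk1.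
nra.
Qed.

(** Summing the recursion over [t] telescopes: [q] times the difference of the sums at levels [k.+1]
    and [k] is at most [a 0 k.+1 - a T k.+1 <= 1]. Each level thus adds at most [1 / q], the mean of
    a geometric waiting time. *)
Lemma spread_sum T k : (k <= N)%N -> \sum_(t < T) a t k <= k%:R / q.
Proof.
case/andP: q01 => q0 q1.
elim: k => [|k IH] kN; first by rewrite big1 ?mul0r// => i _; exact: at0.
have {}IH := IH (ltnW kN).
have telescoped : \sum_(t < T) a t.+1 k.+1 =
    \sum_(t < T) a t k.+1 + a T k.+1 - a 0%N k.+1.
  by rewrite -(big_ord_recr T (fun t => a t k.+1)) big_ord_recl/= [RHS]addrC addKr.
have : \sum_(t < T) a t.+1 k.+1 <=
    \sum_(t < T) ((1 - q) * a t k.+1 + q * a t k).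
  by apply: ler_sum => t _; exact: aS.
rewrite telescoped big_split/= -!mulr_sumr.
rewrite ler_pdivlMr//.
move: IH; rewrite ler_pdivlMr//.
have /andP[aT _] := a01 T k.+1; have /andP[_ a0] := a01 0%N k.+1.
rewrite -natr1; nra.
Qed.

End spread_recursion.

(** * Numerical estimates for the constants *)

Section constants.
Variable R : realType.

Lemma expR_half_le2 : expR (2^-1) <= 2 :> R.
Proof.
rewrite -[leLHS]invrK -expRN -[leRHS]invrK lef_pV2 ?posrE ?invr_gt0 ?expR_gt0//.
by apply: (le_trans _ (expR_ge1Dx _)); lra.
Qed.

(** This turns the mean bound [n - 1] into [2 n ln n]. *)
Lemma ln_ge_half (n : nat) : (1 < n)%N -> 2^-1 <= ln n%:R :> R.
Proof.
move=> n1; have n0 : 0 < n%:R :> R by rewrite ltr0n ltnW.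
rewrite -ler_expR lnK ?posrE//; apply: (le_trans expR_half_le2).
by rewrite ler_nat.
Qed.

(* The choice z = 1 - 1/n balances z^-(n-2) <= e against e^(-q t (1 - z)). *)
Lemma tail_constant (n : nat) (q x z : R) (t : nat) :
  (1 < n)%N -> 0 < q <= 1 -> x * n%:R * ln n%:R / q < t.+1%:R ->
  z = 1 - n%:R^-1 ->
  (1 - q * (1 - z)) ^+ t * z^-1 ^+ n.-2 <= 2 * n%:R `^ (- x + 2).
Proof.
move=> n1 /andP[q0 q1] xt zE.
have n0 : 0 < n%:R :> R by rewrite ltr0n ltnW.
have n2 : 2 <= n%:R :> R by rewrite ler_nat.
have nV0 : 0 < n%:R^-1 :> R by rewrite invr_gt0.
have nV2 : n%:R^-1 <= 2^-1 :> R by rewrite lef_pV2// posrE.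
have z0 : 0 < z by rewrite zE; lra.
have rate : 1 - q * (1 - z) <= expR (- (q / n%:R)).
  by apply: le_trans (expR_ge1Dx _); rewrite zE opprB addrCA subrr addr0.
have rate0 : 0 <= 1 - q * (1 - z) by rewrite zE; nra.
(* The hypothesis bounds [t.+1] rather than [t]; the missing round costs a factor [expR (q / n)], at
   most [expR (1/2) <= 2]. *)
have decay : (1 - q * (1 - z)) ^+ t <= 2 * n%:R `^ (- x).
  apply: (le_trans (lerXn2r t _ _ rate)); rewrite ?nnegrE ?expR_ge0//.
  rewrite -expRM_natl.
  have -> : n%:R `^ (- x) = expR (- x * ln n%:R) :> R.
    by rewrite /powR gt_eqF.
  apply: (@le_trans _ _ (expR (2^-1 + - x * ln n%:R))); last first.
    by rewrite expRD ler_wpM2r ?expR_ge0// expR_half_le2.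
  rewrite ler_expR.
  have : x * ln n%:R <= t.+1%:R * (q / n%:R).
    have -> : x * ln n%:R = (x * n%:R * ln n%:R / q) * (q / n%:R).
      by field; rewrite !gt_eqF.
    by rewrite ler_wpM2r ?divr_ge0 ?(ltW n0) ?(ltW q0)// ltW.
  rewrite -natr1 mulrDl mul1r.
  have : q / n%:R <= 2^-1.
    by rewrite -[leRHS]mul1r ler_pM// ?(ltW q0) ?(ltW nV0).
  lra.
(* Here [z^-1 = 1 + 1/(n-1) <= expR (1/(n-1))], and [(n-2)/(n-1) <= 1], so the power is at most
   [expR 1 <= 2 * 2]. *)
have weight : z^-1 ^+ n.-2 <= 4.
  apply: (@le_trans _ _ (expR (2^-1 + 2^-1))); last first.
    have e2 := expR_half_le2; have e0 := expR_ge0 (2^-1 : R).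
    by rewrite expRD; nra.
  have n1R : 0 < n%:R - 1 :> R by lra.
  have zV : z^-1 <= expR (n%:R - 1)^-1.
    apply: le_trans (expR_ge1Dx _).
    by rewrite le_eqVlt; apply/orP; left; apply/eqP; rewrite zE; field;
       rewrite !gt_eqF//; lra.
  apply: (le_trans (lerXn2r _ _ _ zV)); rewrite ?nnegrE ?expR_ge0 ?invr_ge0 ?(ltW z0)//.
  rewrite -expRM_natl ler_expR ler_pdivrMr//.
  have nE : n%:R = n.-2%:R + 2 :> R by rewrite -natrD addn2; case: (n) n1 => [|[]].
  by rewrite nE; lra.
(* The factor 4 is absorbed by [n ^ 2], whence the [+ 2] in the exponent. *)
have n4 : 4 <= n%:R `^ 2 :> R by rewrite -[2]/(2%:R) powR_mulrn ?(ltW n0)// expr2; nra.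
rewrite powRD ?(gt_eqF n0) ?implybT//.
have xn0 := powR_ge0 n%:R (- x) : 0 <= n%:R `^ (- x) :> R.
apply: (@le_trans _ _ (2 * n%:R `^ (- x) * 4)).
  by rewrite ler_pM ?exprn_ge0// invr_ge0 ltW.
by rewrite -mulrA ler_pM2l// ler_wpM2l.
Qed.

End constants.

(** * Splitting an event along a finite-valued map *)

Section probability_partition.
Context d (Omega : measurableType d) (R : realType) (P : probability Omega R).

Lemma fine_probability (A : set Omega) : measurable A -> (fine (P A))%:E = P A.
Proof. by move=> mA; rewrite fineK// fin_num_measure. Qed.

Lemma probability_partition (F : finType) (f : Omega -> F) (D : set Omega) :
  (forall a, measurable (f @^-1` [set a])) -> measurable D ->
  P D = (\sum_(a : F) P (D `&` f @^-1` [set a]))%E.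
Proof.
move=> mf mD; rewrite -big_enum/= fsbig_seq ?enum_uniq//.
rewrite -measure_fin_bigcup//.
- congr (P _); apply/seteqP; split=> [w Dw|w [a _ []]//].
  by exists (f w) => //=; rewrite mem_enum.
- by move=> i j _ _ [w [[_ /= <-] [_ /= <-]]].
- by move=> a _; exact: measurableI.
Qed.

End probability_partition.

(** * Independence of one variable from events determined by the others *)

Section independence.
Context d (Omega : measurableType d) (R : realType) (P : probability Omega R).
Variables (I : choiceType) (F : finType) (Y : I -> Omega -> F).
Hypothesis Yrv : forall i, discrete_rv (Y i).

(* [D] is an event of the sigma-algebra generated by the [Y j], [j] in [J]. *)
Definition determined_by (J : {fset I}) (D : set Omega) :=
  forall w w', (forall j, j \in J -> Y j w = Y j w') -> D w -> D w'.

Let trace (J : {fset I}) (w : Omega) : {ffun J -> F} :=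
  [ffun j => Y (val j) w].

(** Extending [f] by the full set outside [J] writes a fibre of [trace] as a cylinder, the shape
    that [mutually_independent] speaks of. *)
Let cell (J : {fset I}) (f : {ffun J -> F}) (i : I) : set F :=
  if insub i is Some j then [set f j] else setT.

Let trace_preimage (J : {fset I}) (f : {ffun J -> F}) :
  trace J @^-1` [set f] = \bigcap_(i in [set` J]) (Y i @^-1` cell f i).
Proof.
apply/seteqP; split=> w /=.
  by move=> <- i /= iJ; rewrite /cell insubT/= ffunE.
move=> Yf; apply/ffunP => j; rewrite ffunE.
have := Yf (val j) (valP j); rewrite /cell/=.
by rewrite insubT ?(valP j)// => Pj; rewrite (_ : Sub _ _ = j)//; exact: val_inj.
Qed.

Let trace_measurable (J : {fset I}) (f : {ffun J -> F}) : measurable (trace J @^-1` [set f]).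
Proof.
by rewrite trace_preimage; apply: fin_bigcap_measurable => // i _; exact: Yrv.
Qed.

(** The fibres of [trace] are the atoms of the generated sigma-algebra: [D] cannot separate two
    points that agree on [J]. *)
Let trace_split (J : {fset I}) (D : set Omega) (f : {ffun J -> F}) : determined_by J D ->
  trace J @^-1` [set f] `<=` D \/ D `&` trace J @^-1` [set f] = set0.
Proof.
move=> JD; have [[w [Dw wf]]|DT0] := pselect (D `&` trace J @^-1` [set f] !=set0).
  left => w' /= w'f; apply: JD Dw => j jJ.
  by have := congr1 (fun g : {ffun J -> F} => g [` jJ]%fset) (etrans wf (esym w'f));
    rewrite !ffunE.
by right; apply/eqP; apply/negPn/negP => /set0P.
Qed.

Lemma determined_measurable J D : determined_by J D -> measurable D.
Proof.
move=> JD.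
have -> : D = \bigcup_(f in [set f | trace J @^-1` [set f] `<=` D])
    (trace J @^-1` [set f]).
  apply/seteqP; split=> w; last by case=> f /= fD /fD.
  move=> Dw; exists (trace J w) => //= w' /= ww'.
  by have [|D0] := trace_split (trace J w) JD; [exact|exfalso; have : set0 w by rewrite -D0].
by apply: fin_bigcup_measurable => // f _; exact: trace_measurable.
Qed.

(** Cut [D] into the finitely many atoms it contains. Each atom is a cylinder over [J], and remains
    one over [J] with [i] added when intersected with the event on [Y i], so the product formula
    applies atom by atom. *)
Lemma determined_independent J D i (B : set F) :
  mutually_independent P Y -> determined_by J D -> i \notin J ->
  P (D `&` Y i @^-1` B) = (P D * P (Y i @^-1` B))%E.
Proof.
move=> Yind JD iJ.
have mD := determined_measurable JD.
have mB : measurable (Y i @^-1` B) by exact: Yrv.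
rewrite (probability_partition P (@trace_measurable J))//; last exact: measurableI.
rewrite [P D](probability_partition P (@trace_measurable J))//.
rewrite ge0_sume_distrl//; apply: eq_bigr => f _.
rewrite setIAC.
have [/setIidPr ->|->] := trace_split f JD; last by rewrite set0I measure0 mul0e.
pose B' j := if j == i then B else cell f j.
have eBi : B' i = B by rewrite /B' eqxx.
have eB' j : j \in J -> B' j = cell f j.
  by move=> jJ; rewrite /B'; case: eqP => // ji; rewrite -ji jJ in iJ.
have eJ : \bigcap_(j in [set` J]) (Y j @^-1` B' j) = trace J @^-1` [set f].
  by rewrite trace_preimage; apply: eq_bigcapr => j jJ; rewrite eB'.
have eJi : \bigcap_(j in [set` (i |` J)%fset]) (Y j @^-1` B' j) =
    trace J @^-1` [set f] `&` Y i @^-1` B.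
  rewrite -eJ; apply/seteqP; split=> w.
    move=> Yw; split=> [j /= jJ|].
      by apply: Yw; rewrite /= !inE jJ orbT.
    by have := Yw i; rewrite /= eBi; apply; rewrite !inE eqxx.
  move=> [YJ Yi] j /=; rewrite !inE => /orP[/eqP ->|jJ]; last exact: YJ.
  by rewrite eBi.
by rewrite -eJi -eJ !Yind big_fsetU1//= muleC eBi.
Qed.

Lemma determined_avoid J D i (a : F) (h : R) :
  mutually_independent P Y -> determined_by J D -> i \notin J ->
  P (Y i @^-1` [set a]) = h%:E ->
  P (D `&` Y i @^-1` (~` [set a])) = ((1 - h)%:E * P D)%E.
Proof.
move=> Yind JD iJ Yh; rewrite (determined_independent _ Yind JD iJ) muleC.
by rewrite -preimage_setC probability_setC ?Yh//; exact: Yrv.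
Qed.

End independence.

(** * Covering time of an increasing random set *)

Section covering_time.
Context d (Omega : measurableType d) (R : realType) (P : probability Omega R).
Variables (V : finType) (S : nat -> Omega -> {set V}).

Definition covering_time (w : Omega) : \bar R :=
  ereal_inf [set (t%:R)%:E | t in [set t : nat | S t w = [set: V]%SET]].

Hypothesis S_sub : forall t w, S t w \subset S t.+1 w.

Let uncovered t : set Omega := [set w | S t w != [set: V]%SET].

Lemma covered_after (t m : nat) w :
  (t <= m)%N -> S t w = [set: V]%SET -> S m w = [set: V]%SET.
Proof.
move=> /subnK <-; elim: (m - t)%N => // k IH /IH Sk.
by apply/eqP; rewrite -finset.subTset -Sk; exact: S_sub.
Qed.

Lemma covering_time_ge (t : nat) w :
  S t w != [set: V]%SET -> (t.+1%:R%:E <= covering_time w)%E.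
Proof.
move=> StN; apply/ereal_infP => _ [m /= Sm <-].
rewrite lee_fin ler_nat ltnNge; apply/negP => mt.
by rewrite (covered_after mt Sm) eqxx in StN.
Qed.

Lemma covering_time_le (t : nat) w :
  S t w = [set: V]%SET -> (covering_time w <= t%:R%:E)%E.
Proof. by move=> St; apply: ereal_inf_lbound; exists t. Qed.

(** The covering time is an integer or infinite, so exceeding [x] means exceeding its integer
    part. *)
Lemma covering_time_gt (x : R) : 0 <= x ->
  [set w | (x%:E < covering_time w)%E] = uncovered (Num.truncn x).
Proof.
move=> x0; have /andP[tx xt] := truncn_itv x0.
apply/seteqP; split=> w /=; rewrite /uncovered/=.
  apply: contraTneq => /covering_time_le Tt.
  by rewrite -leNgt; apply: le_trans Tt _; rewrite lee_fin.
by move=> /covering_time_ge; apply: lt_le_trans; rewrite lte_fin.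
Qed.

(** Pointwise form of the tail-sum formula for the mean: by monotonicity the uncovered times are
    exactly those before the covering time. If the set never covers, both sides are infinite. *)
Lemma covering_time_series w :
  covering_time w = (\sum_(t <oo) (\1_(uncovered t) w)%:E)%E.
Proof.
have indic_ge0 t : (0 <= (\1_(uncovered t) w)%:E :> \bar R)%E.
  by rewrite lee_fin.
have [hit|nohit] := pselect (exists t, S t w == [set: V]%SET).
  have [m /eqP Sm mmin] := ex_minnP hit.
  have before t : (t < m)%N -> \1_(uncovered t) w = 1 :> R.
    move=> tm; rewrite indicE mem_set//=; apply/negP => /mmin.
    by rewrite leqNgt tm.
  have after t : (m <= t)%N -> \1_(uncovered t) w = 0 :> R.
    move=> mt; rewrite indicE memNset//= /uncovered/= => /negP; apply.
    by apply/eqP; exact: covered_after Sm.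
  rewrite (nneseries_split _ m)// add0n eseries0; last first.
    by move=> t mt _; rewrite after.
  rewrite adde0 big_mkord (eq_bigr (fun=> 1%E)); last first.
    by move=> t _; rewrite before.
  rewrite sumEFin sumr_const card_ord.
  apply/eqP; rewrite eq_le covering_time_le//=.
  apply/ereal_infP => _ [k /= /eqP Sk <-].
  by rewrite lee_fin ler_nat mmin.
rewrite /covering_time [X in ereal_inf (image X _)](_ : _ = set0); last first.
  by apply/seteqP; split=> // t /= St; apply: nohit; exists t; apply/eqP.
rewrite image_set0 ereal_inf0; apply/esym/eqyP => A A0.
apply: le_trans (nneseries_lim_ge (Num.truncn A).+1 _) => //.
rewrite (eq_bigr (fun=> 1%E)); last first.
  move=> t _; rewrite indicE mem_set//=; apply/eqP => St.
  by apply: nohit; exists t; apply/eqP.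
rewrite big_mkord sumEFin sumr_const card_ord lee_fin ltW//.
by have /andP[] := truncn_itv (ltW A0).
Qed.

Variable q : R.
Hypothesis q01 : 0 < q <= 1.
Hypothesis S_measurable : forall t A, measurable (S t @^-1` [set A]).
Hypothesis S0_neq0 : forall w, S 0%N w != finset.set0.
Hypothesis S_stall : forall t (A : {set V}), A != finset.set0 -> A != [set: V]%SET ->
  (P (S t @^-1` [set A] `&` S t.+1 @^-1` [set A])
    <= (1 - q)%:E * P (S t @^-1` [set A]))%E.

Let S_preimage_measurable t (B : set {set V}) : measurable (S t @^-1` B).
Proof.
have -> : S t @^-1` B = \bigcup_(A in B) (S t @^-1` [set A]).
  by apply/seteqP; split=> [w Bw|w [A BA /= ->]//]; exists (S t w).
by apply: fin_bigcup_measurable => // A _; exact: S_measurable.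
Qed.

(** The array [a] of the scalar recursion, used with [N = #|V|.-1]. *)
Let small t k : R := fine (P [set w | (#|S t w| <= k)%N]).

Let smallE t k : (small t k)%:E = P [set w | (#|S t w| <= k)%N].
Proof.
apply: fine_probability.
exact: (S_preimage_measurable t [set A : {set V} | (#|A| <= k)%N]).
Qed.

Let small01 t k : 0 <= small t k <= 1.
Proof.
rewrite -!lee_fin smallE measure_ge0 probability_le1//.
exact: (S_preimage_measurable t [set A : {set V} | (#|A| <= k)%N]).
Qed.

Let S_neq0 t w : S t w != finset.set0.
Proof.
elim: t => [//|t]; rewrite -!card_gt0 => /leq_trans; apply.
exact: subset_leq_card.
Qed.

Let small_t0 t : small t 0%N = 0.
Proof.
apply/EFin_inj; rewrite smallE (_ : [set w | _] = set0) ?measure0//.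
apply/seteqP; split=> // w /=.
by rewrite leqNgt card_gt0 S_neq0.
Qed.

Let stalled_measurable t k :
  measurable [set w | #|S t w| = k /\ S t.+1 w = S t w].
Proof.
have -> : [set w | #|S t w| = k /\ S t.+1 w = S t w] =
    \bigcup_(A in [set A : {set V} | #|A| = k])
      (S t @^-1` [set A] `&` S t.+1 @^-1` [set A]).
  apply/seteqP; split=> [w /= [Sk SS]|w [A /= Ak [/= -> ->]]//].
  by exists (S t w).
by apply: fin_bigcup_measurable => // A _; apply: measurableI;
  exact: S_measurable.
Qed.

(** Sum [S_stall] over the sets of size [k]; the bounds on [k] make each of them nonempty and
    proper. *)
Let stall_card t k : (0 < k < #|V|)%N ->
  (P [set w | #|S t w| = k /\ S t.+1 w = S t w]
    <= (1 - q)%:E * P [set w | #|S t w| = k])%E.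
Proof.
move=> /andP[k0 kn].
have mk : measurable [set w | #|S t w| = k].
  exact: (S_preimage_measurable t [set A : {set V} | #|A| = k]).
have mE := stalled_measurable t k.
rewrite (probability_partition P (S_measurable t) mE).
rewrite (probability_partition P (S_measurable t) mk).
rewrite ge0_sume_distrr//; apply: lee_sum => A _.
have [Ak|Ak] := eqVneq #|A| k; last first.
  rewrite [X in P X](_ : _ = set0) ?measure0; last first.
    by apply/seteqP; split=> // w [[/= Sk _] /= SA]; rewrite -SA Sk eqxx in Ak.
  by rewrite mule_ge0// lee_fin; case/andP: q01; lra.
have -> : [set w | #|S t w| = k /\ S t.+1 w = S t w] `&` S t @^-1` [set A] =
    S t @^-1` [set A] `&` S t.+1 @^-1` [set A].
  apply/seteqP; split=> w /= [].
    by move=> [_ ->] ->.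
  by move=> SA ->; rewrite SA.
have -> : [set w | #|S t w| = k] `&` S t @^-1` [set A] = S t @^-1` [set A].
  by apply/seteqP; split=> w /= => [[]//|SA]; rewrite SA.
apply: S_stall; first by rewrite -card_gt0 Ak.
by apply: contraTneq kn => AT; rewrite -Ak AT cardsT ltnn.
Qed.

Let smallS t k : (k < #|V|.-1)%N ->
  small t.+1 k.+1 <= (1 - q) * small t k.+1 + q * small t k.
Proof.
move=> kN; have kn : (0 < k.+1 < #|V|)%N by move: kN; case: #|V|.
have mle u j : measurable [set w | (#|S u w| <= j)%N].
  exact: (S_preimage_measurable u [set A : {set V} | (#|A| <= j)%N]).
have mk : measurable [set w | #|S t w| = k.+1].
  exact: (S_preimage_measurable t [set A : {set V} | #|A| = k.+1]).
have mst := stalled_measurable t k.+1.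
have split_card : ((small t k.+1)%:E =
    (small t k)%:E + P [set w | #|S t w| = k.+1])%E.
  rewrite !smallE -measureU//; last first.
    by apply/seteqP; split=> // w [/= + Sk]; rewrite Sk ltnn.
  congr (P _); apply/seteqP; split=> w /=.
    by rewrite leq_eqVlt => /orP[/eqP|]; [right|left].
  by move=> [/leqW|->].
(* As the sets increase, size at most [k.+1] after the round leaves two cases: size at most [k]
   before it, or size [k.+1] and no growth. *)
have cover : [set w | (#|S t.+1 w| <= k.+1)%N] `<=`
    [set w | (#|S t w| <= k)%N] `|`
    [set w | #|S t w| = k.+1 /\ S t.+1 w = S t w].
  move=> w /= Sk1; have [|kS] := leqP #|S t w| k; [by left|right].
  have cSS := subset_leq_card (S_sub t w).
  have Sk : #|S t w| = k.+1 by apply/eqP; rewrite eqn_leq kS (leq_trans cSS).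
  split=> //; apply/esym/eqP; rewrite eqEcard S_sub/=.
  by rewrite Sk.
have step : ((small t.+1 k.+1)%:E <=
    (small t k)%:E + (1 - q)%:E * P [set w | #|S t w| = k.+1])%E.
  rewrite !smallE; apply: (@le_trans _ _ (P ([set w | (#|S t w| <= k)%N] `|`
    [set w | #|S t w| = k.+1 /\ S t.+1 w = S t w]))).
    by apply: le_measure; rewrite ?inE//; exact: measurableU.
  apply: le_trans (measureU2 _ _ _) _ => //.
  by rewrite leeD2l//; exact: stall_card.
move: step split_card; rewrite -(fine_probability P mk) -EFinM -!EFinD lee_fin.
by move=> step [->]; lra.
Qed.

Let uncoveredE t : P (uncovered t) = (small t #|V|.-1)%:E.
Proof.
rewrite smallE; congr (P _); apply/seteqP; split=> w; rewrite /uncovered/=.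
  move=> SN; have : (#|S t w| < #|V|)%N.
    by rewrite -cardsT proper_card// properT.
  by case: #|V|.
move=> SV; apply: contraTneq SV => ->; rewrite cardsT -ltnNge.
(* A sample point exists, and its set is nonempty; hence [#|V|] is positive and its predecessor is
   strictly smaller. *)
have := S_neq0 0 point; rewrite -card_gt0 => /leq_trans /(_ (max_card _)).
by case: #|V|.
Qed.

Lemma covering_time_tail (x : R) :
  (P [set w | ((x * #|V|%:R * ln #|V|%:R / q)%:E < covering_time w)%E]
    <= (2 * #|V|%:R `^ (- x + 2))%:E)%E.
Proof.
case/andP: (q01) => q0 q1.
have V0 : (0 < #|V|)%N.
  have := S_neq0 0 point; rewrite -card_gt0 => /leq_trans; apply.
  exact: max_card.
have lnV : 0 <= ln #|V|%:R :> R by apply: ln_ge0; rewrite ler1n.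
(* A negative threshold forces [x < 0]; the event is then everything, and the claimed bound is at
   least 1. *)
have [y0|y0] := ltP (x * #|V|%:R * ln #|V|%:R / q) 0.
  rewrite [X in P X](_ : _ = setT); last first.
    apply/seteqP; split=> // w _ /=; rewrite (@lt_le_trans _ _ 0%E)// ?lte_fin//.
    by apply/ereal_infP => _ [m _ <-]; rewrite lee_fin.
  have x0 : x < 0.
    rewrite ltNge; apply: contraTN y0 => x0; rewrite -leNgt.
    by rewrite !mulr_ge0// invr_ge0 ltW.
  have : 1 <= #|V|%:R `^ (- x + 2) :> R.
    by rewrite -[leLHS](powRr0 #|V|%:R) ler_powR// ?ler1n//; lra.
  by rewrite probability_setT lee_fin; lra.
rewrite covering_time_gt// uncoveredE lee_fin.
(* With a single vertex the nonempty set is already full, and the tail vanishes. *)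
have [V1|V1] := leqP #|V| 1.
  have -> : #|V|.-1 = 0%N by case: #|V| V1 => [|[]].
  by rewrite small_t0 mulr_ge0 ?powR_ge0.
have n2 : 2 <= #|V|%:R :> R by rewrite ler_nat.
have nV : 0 < #|V|%:R^-1 :> R by rewrite invr_gt0; lra.
have nV2 : #|V|%:R^-1 <= 2^-1 :> R by rewrite lef_pV2// posrE; lra.
have z01 : 0 < (1 - #|V|%:R^-1 : R) <= 1 by apply/andP; split; lra.
have N2 : (#|V|.-2 < #|V|.-1)%N by case: #|V| V1 => [|[]].
have /andP[_ /(tail_constant V1 q01)] := truncn_itv y0.
move=> /(_ _ erefl); apply: le_trans.
have := spread_tail q01 small01 small_t0 smallS
  (Num.truncn (x * #|V|%:R * ln #|V|%:R / q)) z01 N2.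
by have -> : #|V|.-2.+1 = #|V|.-1 by case: #|V| V1 => [|[]].
Qed.

(** Integrating the tail series term by term gives the sum of [small t #|V|.-1], whose partial sums
    [spread_sum] bounds uniformly. *)
Lemma covering_time_expectation :
  (\int[P]_w covering_time w <= (#|V|.-1%:R / q)%:E)%E.
Proof.
have mU t : measurable (uncovered t).
  exact: (S_preimage_measurable t [set A | A != [set: V]%SET]).
under eq_integral do rewrite covering_time_series.
rewrite integral_nneseries//; last first.
  by move=> t; apply/measurable_EFinP; exact: measurable_indic.
apply: lime_le; first by apply: is_cvg_nneseries => t _ _; exact: integral_ge0.
apply: nearW => T.
rewrite (eq_bigr (fun t => (small t #|V|.-1)%:E)); last first.
  by move=> t _; rewrite integral_indic// setIT; exact: uncoveredE.
rewrite sumEFin lee_fin big_mkord.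
exact: (spread_sum q01 small01 small_t0 smallS).
Qed.

End covering_time.

(** * Gnostic sets and boundary edges *)

Section pull_model.
Variables (V : finType) (K : Type).

(** Colours can be forgotten: this set evolves as a function of itself and the selections alone. *)
Definition gnostic (x : config V K) : {set V} :=
  [set v | isSome (x v)]%SET.

Lemma gnosticP (x : config V K) v : reflect (x v <> None) (v \in gnostic x).
Proof. by rewrite finset.inE; case: (x v) => [c|]; constructor. Qed.

Lemma gnostic_setT (x : config V K) :
  (forall v, x v <> None) <-> gnostic x = [set: V]%SET.
Proof.
split=> [xN|xT v]; last by apply/gnosticP; rewrite xT finset.in_setT.
by apply/setP => v; rewrite finset.in_setT; apply/gnosticP.
Qed.

Lemma pull_gnostic (x : config V K) v u :
  isSome (pull x v u) = (v \in gnostic x) || (u \in gnostic x).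
Proof. by rewrite /pull !finset.inE; case: (x u) => [c|]; rewrite ?orbT ?orbF. Qed.

Lemma gnostic_sync_step (x : config V K) s v :
  (v \in gnostic (sync_step x s)) = (v \in gnostic x) || (s v \in gnostic x).
Proof. by rewrite finset.inE pull_gnostic. Qed.

Lemma gnostic_async_step (x : config V K) v u v' :
  (v' \in gnostic (async_step x v u)) =
  (v' \in gnostic x) || (v' == v) && (u \in gnostic x).
Proof.
rewrite [LHS]finset.inE /async_step; case: eqP => [->|_]; first exact: pull_gnostic.
by rewrite finset.inE orbF.
Qed.

(** Follow a path from a vertex outside [A] to one inside and take the edge on which it first enters
    [A]. The edge points into [A] because colours are pulled. *)
Lemma boundary_edge (E : rel V) (A : {set V}) :
  strongly_connected E -> A != finset.set0 -> A != [set: V]%SET ->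
  exists v u, [/\ v \notin A, u \in A & E v u].
Proof.
move=> Econ /set0Pn[a aA]; rewrite -finset.subTset => /subsetPn[b _ bA].
have /connectP[s] := Econ b a.
elim: s b bA => [|c s IH] b bA /=; first by move=> _ ab; rewrite -ab aA in bA.
move=> /andP[Ebc cs] ea.
have [cA|cA] := boolP (c \in A); first by exists b, c.
exact: IH cA cs ea.
Qed.

End pull_model.

(** * The gnostic set stalls with probability at most one minus the rate *)

Section gnostic_growth.
Context d (Omega : measurableType d) (R : realType) (P : probability Omega R).
Variables (V : finType) (E : rel V) (H : V -> V -> R) (p : R) (K : Type).
Variables (x0 : config V K) (X : nat -> Omega -> config V K).
Hypothesis hE : strongly_connected E.
Hypothesis hH : transition_matrix E H.
Hypothesis hp : smallest_nonzero_entry H p.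

Let H_ge0 v u : 0 <= H v u.
Proof.
case: hH => _ HE HN; have [/HE/ltW//|/HN->//] := boolP (E v u).
Qed.

Lemma smallest_entry_bounds : 0 < p <= 1.
Proof.
case: hp => p0 [v [u Hp]] _; case: hH => H1 _ _.
rewrite lt_def p0 -Hp H_ge0/= -(H1 v) (bigD1 u)//= lerDl.
by apply: sumr_ge0.
Qed.

Let p_le v u : E v u -> p <= H v u.
Proof.
by move=> Evu; case: hp => _ _; apply; case: hH => _ /(_ _ _ Evu)/gt_eqF ->.
Qed.

Let S t w := gnostic (X t w).

(** Shared by both schedules: a stall at [A] rules out the selection [Y i = a], which is independent
    of the past [J] and has probability [h >= q]. *)
Lemma stall_from_independence (I : choiceType) (F : finType)
    (Y : I -> Omega -> F) (q h : R) t (A : {set V}) (J : {fset I}) i a :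
  (forall i, discrete_rv (Y i)) -> mutually_independent P Y ->
  determined_by Y J (S t @^-1` [set A]) -> i \notin J ->
  P (Y i @^-1` [set a]) = h%:E -> q <= h ->
  (forall w, S t w = A -> Y i w = a -> S t.+1 w != A) ->
  measurable (S t.+1 @^-1` [set A]) ->
  (P (S t @^-1` [set A] `&` S t.+1 @^-1` [set A])
    <= (1 - q)%:E * P (S t @^-1` [set A]))%E.
Proof.
move=> Yrv Yind SJ iJ Yh qh grow mS1.
have mS := determined_measurable Yrv SJ.
apply: (@le_trans _ _ (P (S t @^-1` [set A] `&` Y i @^-1` (~` [set a])))).
  apply: le_measure; rewrite ?inE//; first exact: measurableI.
    by apply: measurableI => //; exact: Yrv.
  move=> w [SA S1A]; split=> //= Ya.
  by have := grow w SA Ya; rewrite S1A eqxx.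
rewrite (determined_avoid Yrv Yind SJ iJ Yh) lee_wpmul2r//.
by rewrite lee_fin; lra.
Qed.

Lemma sync_determined (Y : nat -> V -> Omega -> V) t w w' :
  (forall w, X 0%N w = x0) ->
  (forall t w, X t.+1 w = sync_step (X t w) (fun v => Y t v w)) ->
  (forall s v, (s < t)%N -> Y s v w = Y s v w') -> X t w = X t w'.
Proof.
move=> X0 XS; elim: t => [|t IH] Yw; first by rewrite !X0.
rewrite !XS IH; last by move=> s v st; apply: Yw; exact: leqW.
by congr sync_step; apply/funext => v; exact: Yw.
Qed.

Lemma async_determined (Y : nat -> Omega -> V * V) t w w' :
  (forall w, X 0%N w = x0) ->
  (forall t w, X t.+1 w = async_step (X t w) (Y t w).1 (Y t w).2) ->
  (forall s, (s < t)%N -> Y s w = Y s w') -> X t w = X t w'.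
Proof.
move=> X0 XS; elim: t => [|t IH] Yw; first by rewrite !X0.
rewrite !XS IH ?Yw// => s st; apply: Yw; exact: leqW.
Qed.

(** Asynchronously the tail of the boundary edge must first be the chosen node, which has
    probability [1 / #|V|]. *)
Definition growth_rate (s : schedule) : R :=
  if s is Synchronous then p else p / #|V|%:R.

Lemma gnostic_growth (s : schedule) : pull_process s P H x0 X ->
  [/\ forall w, X 0%N w = x0,
      forall t w, S t w \subset S t.+1 w,
      forall t A, measurable (S t @^-1` [set A])
    & forall t (A : {set V}), A != finset.set0 -> A != [set: V]%SET ->
        (P (S t @^-1` [set A] `&` S t.+1 @^-1` [set A])
          <= (1 - growth_rate s)%:E * P (S t @^-1` [set A]))%E].
Proof.
case: s => [] [Y [Yrv Ylaw Yind X0 XS]].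
- pose Y' (i : nat * V) := Y i.1 i.2.
  have Yrv' i : discrete_rv (Y' i) by exact: Yrv.
  (* All selections of the rounds before [t]; the selection [(t, v)] that is to use the boundary
     edge lies outside. *)
  pose J t := [fset i in [seq (s, v) | s <- iota 0 t, v <- enum V]]%fset.
  have memJ t i : (i \in J t) = (i.1 < t)%N.
    rewrite in_fset/=; apply/allpairsP/idP => [[[s v] [/= + _ ->]]|it].
      by rewrite mem_iota.
    by exists i; rewrite mem_iota mem_enum/= it; case: (i).
  have SJ t A : determined_by Y' (J t) (S t @^-1` [set A]).
    move=> w w' Yw /= <-; congr gnostic; apply/esym.
    apply: (sync_determined X0 XS) => s v st.
    by apply: (Yw (s, v)); rewrite memJ.
  have mS t A := determined_measurable Yrv' (SJ t A).
  split=> //.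
    move=> t w; apply/fintype.subsetP => v.
    by rewrite /S XS gnostic_sync_step => ->.
  move=> t A A0 AT; have [v [u [vA uA Evu]]] := boundary_edge hE A0 AT.
  apply: (@stall_from_independence _ _ Y' _ (H v u) t A (J t) (t, v) u) => //.
  + by rewrite memJ/= ltnn.
  + exact: Ylaw.
  + exact: p_le.
  + move=> w SA Yu; apply: contraNneq vA => <-.
    by rewrite /S XS gnostic_sync_step (Yu : Y t v w = u) -/(S t w) SA uA orbT.
- pose J t := [fset i in iota 0 t]%fset.
  have memJ t i : (i \in J t) = (i < t)%N by rewrite in_fset/= mem_iota.
  have SJ t A : determined_by Y (J t) (S t @^-1` [set A]).
    move=> w w' Yw /= <-; congr gnostic; apply/esym.
    apply: (async_determined X0 XS) => s st.
    by apply: Yw; rewrite memJ.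
  have mS t A := determined_measurable Yrv (SJ t A).
  split=> //.
    move=> t w; apply/fintype.subsetP => v.
    by rewrite /S XS gnostic_async_step => ->.
  move=> t A A0 AT; have [v [u [vA uA Evu]]] := boundary_edge hE A0 AT.
  (* One variable per round here: the value [(v, u)] both chooses the node and uses the boundary
     edge. *)
  apply: (@stall_from_independence _ _ Y _ (#|V|%:R^-1 * H v u) t A (J t) t (v, u)) => //.
  + by rewrite memJ ltnn.
  + by rewrite /= mulrC ler_wpM2l ?invr_ge0// p_le.
  + move=> w SA Yu; apply: contraNneq vA => <-.
    by rewrite /S XS gnostic_async_step Yu/= eqxx -/(S t w) SA uA orbT.
Qed.

End gnostic_growth.

(** * Tail and mean of the agnostic time *)

Unset Implicit Arguments.

Theorem corollary2 (R : realType) (V : finType) (E : rel V)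
    (H : V -> V -> R) (p : R) (s : schedule) (K : Type)
    (d : measure_display) (Omega : measurableType d)
    (P : probability Omega R)
    (x0 : config V K) (X : nat -> Omega -> config V K)
    (hE : strongly_connected E)
    (hH : transition_matrix E H)
    (hp : smallest_nonzero_entry H p)
    (hX : pull_process s P H x0 X)
    (hx0 : exists v, x0 v <> None) :
  let n := #|V| in
  let Ta := agnostic_time R X in
  let g := time_scale R s in
  (forall C : nat -> R,
     (P [set w | ((C n * n%:R * g n / p)%:E < Ta w)%E]
        <= (2 * n%:R `^ (- C n + 2))%:E)%E) /\
  (\int[P]_w Ta w <= (2 * n%:R * g n / p + 4)%:E)%E.
Proof.
case: hx0 => v0 xv0.
have [X0 Ssub Sm Sstall] := gnostic_growth hE hH hp hX.
have /andP[p0 p1] := smallest_entry_bounds hH hp.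
have V0 : (0 < #|V|)%N by apply/card_gt0P; exists v0.
have n1 : 1 <= #|V|%:R :> R by rewrite ler1n.
have n0 : 0 < #|V|%:R :> R by lra.
have S0 w : gnostic (X 0%N w) != finset.set0.
  by apply/set0Pn; exists v0; apply/gnosticP; rewrite X0.
have TaE : agnostic_time R X = covering_time R (fun t w => gnostic (X t w)).
  apply/funext => w; congr (ereal_inf (image _ _)).
  by apply/seteqP; split=> t /= /gnostic_setT.
have q01 : 0 < growth_rate V p s <= 1.
  rewrite /growth_rate; case: (s) => //; first by rewrite p0.
  by rewrite divr_gt0//= ler_pdivrMr//; lra.
(* The extra factor [n] of the asynchronous time scale is the [n] in the rate [p / n], so from here
   both schedules are treated alike. *)
have scaleE x : x * #|V|%:R * time_scale R s #|V| / p =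
    x * #|V|%:R * ln #|V|%:R / growth_rate V p s.
  rewrite /time_scale /growth_rate; case: (s) => //.
  by field; rewrite !gt_eqF.
move=> n Ta g; split=> [C|].
  rewrite /Ta TaE scaleE.
  exact: covering_time_tail.
rewrite /Ta TaE scaleE.
apply: le_trans (covering_time_expectation _ q01 _ _ _) _ => //.
rewrite lee_fin -/n.
have q0 : 0 < growth_rate V p s by case/andP: q01.
apply: (@le_trans _ _ (2 * n%:R * ln n%:R / growth_rate V p s)); last by lra.
rewrite ler_pM2r ?invr_gt0//.
(* For [n = 1] the logarithm vanishes, but so does [n - 1]; otherwise [n - 1 <= n <= 2 n ln n]. *)
have [N1|N1] := leqP n 1.
  have -> : n.-1 = 0%N by case: (n) N1 => [|[]].
  by rewrite !mulr_ge0// ln_ge0.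
have := ln_ge_half R N1.
have : n.-1%:R <= n%:R :> R by rewrite ler_nat leq_pred.
have : 1 <= n%:R :> R by [].
nra.
Qed.
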